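(* For every $\sigma\in \mathrm{U}(V,h')$, let $\tilde{\sigma}$ denote $\sigma$ regarded as an ($F$-linear) element of the orthogonal group $\mathrm{O}(V,b_h)$. Then $$\mathrm{sn}(\tilde{\sigma})=\mathrm{Norm}_{E/F}(\mathrm{sn}_E(\sigma)) \quad\text{in } F^\times/(F^\times)^2,$$ where $\mathrm{Norm}_{E/F}: E^{\times}/E_0^{\times}\to F^\times/(F^\times)^2$ is the homomorphism induced by the norm of $E$ over $F$.
   Context: $F$ is a field of characteristic not equal to $2$, and $E$ is a finite extension of $F$ equipped with an involution $\bar{\ }$ (a field automorphism of order two) fixing all elements of $F$. $E_0\supseteq F$ denotes the subfield of $E$ of fixed points of the involution. Fix a non-zero $F$-linear form $\mu_0:E_0\to F$ and put $\mu=\mu_0\circ\mathrm{tr}_{E/E_0}$. $V$ is a finite-dimensional $E$-vector space and $h:V\times V\to E$ is a non-degenerate hermitian form (sesquilinear forms are $E$-linear in the second variable and semilinear in the first). Viewing $V$ as an $F$-vector space, $b_h(x,y)=\mu(h(x,y))$ is a non-degenerate symmetric $F$-bilinear form on $V$. $\mathrm{U}(V,h)$ is the unitary group of $h$ and $\mathrm{O}(V,b_h)$ the orthogonal group of $b_h$; $\mathrm{U}(V,h)\subset \mathrm{O}(V,b_h)$. $h'$ is a non-degenerate anti-hermitian form on $V$ such that $\mathrm{U}(V,h')=\mathrm{U}(V,h)$. Spinor norm on $\mathrm{O}(V,b_h)$: $\mathrm{sn}:\mathrm{O}(V,b_h)\to F^\times/(F^\times)^2$ is the usual spinor norm homomorphism,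 which sends the reflection in a non-isotropic vector $v$ to the class of $b_h(v,v)$; by Zassenhaus, $\mathrm{sn}(-1)=\mathrm{disc}(b_h)$, and for $\tilde\sigma\neq -1$, $$\mathrm{sn}(\tilde\sigma)=\mathrm{disc}\left(b_h|_{\bigcup_{i\ge1}\ker(1+\tilde\sigma)^i}\right){\det}_F\left(\tfrac{1+\tilde\sigma}{2}\big|_{\bigcap_{i\ge1}\mathrm{im}(1+\tilde\sigma)^i}\right),$$ where $\mathrm{disc}$ is the class in $F^\times/(F^\times)^2$ of the determinant of a Gram matrix (without sign), and discriminants and determinants on the zero space are $1$. Spinor norm on $\mathrm{U}(V,h')$ (Wall): for $\sigma\in\mathrm{U}(V,h')$ let $V_\sigma$ be the image of $1-\sigma$; $\sigma$ has dimension $r$ if $\dim_E V_\sigma=r$. The elements of dimension $1$ are the maps $s_{(v,\varphi)}(x)=x-\varphi h'(v,x)v$ with $v\in V$ non-zero and $\varphi\in E^\times$ satisfying $\varphi^{-1}-\bar\varphi^{-1}=h'(v,v)$. For $\sigma$ of dimension $r>0$, let $f_\sigma:V_\sigma\times V_\sigma\to E$ be the sesquilinear form $(x-\sigma(x),y-\sigma(y))\mapsto h'(x-\sigma(x),y)$. Then $\sigma$ has a Cayley decomposition, i.e. it can be written $\sigma=s_{(v_1,\varphi_1)}\cdots s_{(v_r,\varphi_r)}$ where $v_1,\dots,v_r$ form a basis of $V_\sigma$, orthogonal with respect to $f_\sigma$ (orthogonality being one-sided since $f_\sigma$ need not be reflexive). Fix a vector $a\in V$ and choose the $v_i$ so that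 each $h'(a,v_i)$ is $0$ or $1$; then the class $\varphi_1\cdots\varphi_rE_0^\times\in E^\times/E_0^\times$ depends only on $\sigma$, and $\mathrm{sn}_E(\sigma)=\varphi_1\cdots\varphi_rE_0^\times$. One sets $\mathrm{sn}_E(1)=E_0^\times$. The map $\mathrm{sn}_E:\mathrm{U}(V,h')\to E^\times/E_0^\times$ is a group homomorphism; in particular $\mathrm{sn}_E(s_{(v,\varphi)})=\varphi E_0^\times$. *)

(* Defs.v *)
From HB Require Import structures.
From mathcomp Require Import all_boot all_algebra all_field.
From mathcomp Require Import boolp classical_sets.

Set Implicit Arguments.
Unset Strict Implicit.
Unset Printing Implicit Defensive.

Import GRing.Theory.
Local Open Scope ring_scope.

(* Restriction of scalars: an E-vector space seen as an F-vector space. *)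
Section BaseVect.

Variables (F : fieldType) (E : fieldExtType F) (V : vectType E).

Definition baseVectType : Type := V.
Notation V0 := baseVectType.

HB.instance Definition _ := GRing.Zmodule.on V0.

Definition baseVect_scale (a : F) (u : V0) : V0 := a%:A *: (u : V).

Fact baseVect_scaleA a b u :
  baseVect_scale a (baseVect_scale b u) = baseVect_scale (a * b) u.
Proof. by rewrite /baseVect_scale scalerA -scalerAl mul1r scalerA. Qed.

Fact baseVect_scale1 u : baseVect_scale 1 u = u.
Proof. by rewrite /baseVect_scale scale1r scale1r. Qed.

Fact baseVect_scaleDr a u v :
  baseVect_scale a (u + v) = baseVect_scale a u + baseVect_scale a v.
Proof. exact: scalerDr. Qed.

Fact baseVect_scaleDl v a b :
  baseVect_scale (a + b) v = baseVect_scale a v + baseVect_scale b v.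
Proof. by rewrite /baseVect_scale !scalerDl. Qed.

HB.instance Definition _ := GRing.Zmodule_isLmodule.Build F V0
  baseVect_scaleA baseVect_scale1 baseVect_scaleDr baseVect_scaleDl.

Lemma baseVect_scaleE (a : F) (u : V) : a *: (u : V0) = a%:A *: u :> V.
Proof. by []. Qed.

Fact baseVect_vectMixin : Lmodule_hasFinDim F V0.
Proof.
pose bF : (\dim {:E}).-tuple E := vbasis {:E}.
pose bV := vbasis {:V}; set m := \dim {:V} in bV.
pose n := \dim {:E}.
pose v2r (x : V0) : 'rV[F]_(m * n) :=
  mxvec (\matrix_(i, j) coord bF j (coord bV i (x : V))).
have v2r_lin : linear v2r.
  move=> a x y; rewrite -linearP; congr mxvec; apply/matrixP=> i j.
  rewrite !mxE baseVect_scaleE linearP /= mulr_algl.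
  by rewrite linearP.
pose r2v (r : 'rV[F]_(m * n)) : V0 :=
  \sum_(i < m) (\sum_(j < n) vec_mx r i j *: bF`_j) *: (bV`_i : V).
have v2rK : cancel v2r r2v.
  move=> x; transitivity (\sum_(i < m) coord bV i (x : V) *: bV`_i); last first.
    by rewrite -coord_vbasis ?memvf.
  apply: eq_bigr => i _; rewrite mxvecK; congr (_ *: _ : V).
  rewrite [RHS](coord_vbasis (memvf (coord bV i (x : V)))).
  by apply: eq_bigr => j _; rewrite mxE.
exists (m * n)%N, v2r => //; exists r2v => // r.
apply: (canLR vec_mxK); apply/matrixP=> i j; rewrite mxE.
by rewrite !coord_sum_free ?(basis_free (vbasisP _)).
Qed.

HB.instance Definition _ := baseVect_vectMixin.

Definition base_fun (s : 'End(V)) (x : V0) : V0 := s x.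

Fact base_fun_linear (s : 'End(V)) : linear (base_fun s).
Proof. by move=> a x y; rewrite /base_fun !baseVect_scaleE linearP. Qed.

HB.instance Definition _ (s : 'End(V)) :=
  GRing.isLinear.Build F V0 V0 _ (base_fun s) (base_fun_linear s).

Definition base_lfun (s : 'End(V)) : 'End(V0) := linfun (base_fun s).

Lemma base_lfunE (s : 'End(V)) (x : V) : base_lfun s x = s x.
Proof. by rewrite lfunE. Qed.

End BaseVect.

Section Forms.

Variables (K : fieldType) (U : vectType K) (R : nmodType).

Definition nondegenerate_form (b : U -> U -> R) : Prop :=
  forall x, (forall y, b x y = 0) -> x = 0.

Definition isometry_group (b : U -> U -> R) : set 'End(U) :=
  [set g | lker g == 0%VS /\ forall x y, b (g x) (g y) = b x y].

End Forms.

Section SpinorNorm.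

Variables (K : fieldType) (U : vectType K) (b : U -> U -> K).

(* The coset of c modulo the non-zero squares of K. *)
Definition square_class (c : K) : set K :=
  [set c * d ^+ 2 | d in [set d : K | d != 0]].

Definition reflection (v x : U) : U := x - (2%:R * b v x / b v v) *: v.

(* g = r_{v_1} ... r_{v_n} with all the v_i anisotropic *)
Definition reflection_product (g : 'End(U)) (vs : seq U) : Prop :=
  all (fun v => b v v != 0) vs /\ forall x, g x = foldr reflection x vs.

(* The class of b(v_1,v_1) ... b(v_n,v_n) for some factorization
   g = r_{v_1} ... r_{v_n}; every element of the orthogonal group of a
   non-degenerate form in characteristic not 2 has one, and the class does not
   depend on it, so that this is the homomorphism sending r_v to b(v,v). *)
Definition spinor_norm (g : 'End(U)) : set K :=
  square_class (\prod_(v <- xget [::] (reflection_product g)) b v v).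

End SpinorNorm.

Section UnitarySpinorNorm.

Variables (F : fieldType) (E : fieldExtType F) (theta : 'AEnd(E)).
Variable V : vectType E.

(* Semilinear in the first variable, linear in the second. *)
Definition sesquilinear_form :=
  {bilinear V -> V -> E | (theta \; *%R) & *%R}.

Definition hermitian_form (h : sesquilinear_form) : Prop :=
  forall x y, h y x = theta (h x y).

Definition antihermitian_form (h : sesquilinear_form) : Prop :=
  forall x y, h y x = - theta (h x y).

(* The trace of the quadratic Galois extension E / E_0. *)
Definition trace_fixed (x : E) : subvs_of (fixedSpace theta) :=
  vsproj (fixedSpace theta) (x + theta x).

Lemma trace_fixedE (x : E) : involutive theta ->
  vsval (trace_fixed x) = x + theta x.
Proof.
move=> thetaK; rewrite vsprojK //; apply/fixedSpaceP.
by rewrite rmorphD /= thetaK addrC.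
Qed.

Definition transfer_form (mu0 : 'Hom(subvs_of (fixedSpace theta), F^o))
    (h : sesquilinear_form) (x y : baseVectType V) : F :=
  mu0 (trace_fixed (h x y)).

Lemma base_lfun_isometry (mu0 : 'Hom(subvs_of (fixedSpace theta), F^o))
    (h : sesquilinear_form) (sigma : 'End(V)) :
  isometry_group h sigma ->
  isometry_group (transfer_form mu0 h) (base_lfun sigma).
Proof.
move=> [ker0 hE]; split; last first.
  by move=> x y; rewrite /transfer_form !base_lfunE hE.
apply/lker0P => x y; rewrite !base_lfunE.
exact: (lker0P ker0).
Qed.

Variable h : sesquilinear_form.

(* s_(v, phi), for p = (v, phi) *)
Definition quasi_reflection (p : V * E) (x : V) : V :=
  x - (p.2 * h p.1 x) *: p.1.

(* On V_sigma = im (1 - sigma), this is the form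
   (x - sigma x, y - sigma y) |-> h (x - sigma x) y: it does not depend on the
   preimage of w by 1 - sigma, as the kernel of 1 - sigma is orthogonal to
   V_sigma when sigma is an isometry. *)
Definition wall_form (sigma : 'End(V)) (u w : V) : E :=
  h u ((\1%VF - sigma)^-1%VF w).

(* sigma = s_(v_1, phi_1) ... s_(v_r, phi_r). The side on which the v_i are
   orthogonal is dictated by the order of the factors: such a product always
   has f_sigma(v_j, v_i) = 0 for i < j, and f_sigma(v_i, v_j) = h(v_i, v_j). *)
Definition cayley_decomposition (sigma : 'End(V)) (ps : seq (V * E)) : Prop :=
  [/\ forall p, p \in ps ->
        p.2 != 0 /\ p.2^-1 - theta p.2^-1 = h p.1 p.1,
      basis_of (limg (\1%VF - sigma)) [seq p.1 | p <- ps],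
      pairwise (fun v w => wall_form sigma w v == 0) [seq p.1 | p <- ps]
    & forall x, sigma x = foldr quasi_reflection x ps].

Definition normalized_decomposition (a : V) (sigma : 'End(V))
    (ps : seq (V * E)) : Prop :=
  cayley_decomposition sigma ps /\
  forall p, p \in ps -> (h a p.1 == 0) || (h a p.1 == 1).

(* The coset of phi modulo the multiplicative group of E_0. *)
Definition fixed_class (phi : E) : set E :=
  [set phi * e | e in [set e : E | (e \in fixedSpace theta) && (e != 0)]].

(* For sigma = 1 the only Cayley decomposition is the empty one, and the
   value is the trivial coset. *)
Definition unitary_spinor_norm (a : V) (sigma : 'End(V)) : set E :=
  fixed_class
    (\prod_(p <- xget [::] (normalized_decomposition a sigma)) p.2).

End UnitarySpinorNorm.

Section FieldNorm.

Variables (F : fieldType) (E : fieldExtType F).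

Definition field_norm (x : E) : F :=
  \det (passmx.mxof (vbasis {:E}) (vbasis {:E}) (amull x)).

(* The map induced by the norm on cosets, from the units of E modulo those of
   E_0 to the units of F modulo squares: the image of a coset C is the union of
   the square classes of the norms of its elements. *)
Definition norm_class (C : set E) : set F :=
  [set c | exists2 x, C x & square_class (field_norm x) c].

End FieldNorm.

(* Main.v *)
Require Import Defs.
From HB Require Import structures.
From mathcomp Require Import all_boot all_fingroup all_algebra all_field.
From mathcomp Require Import boolp classical_sets.
From mathcomp Require Import ring.

Set Implicit Arguments.
Unset Strict Implicit.
Unset Printing Implicit Defensive.

Import GRing.Theory.
Local Open Scope ring_scope.

(** Wall matrices make the two spinor norms comparable. Let b be a symmetric
    bilinear form. A Wall matrix of g is an invertible matrix T, together with
    vectors a_1, ..., a_n such that, if A is the matrix with columns a_i and A'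
    the map sending x to the column of the 2 b(a_i, x),
      g = 1 - A T^-1 A'   and   T + T^tr = A' A.
    The vectors a_i may be dependent, so g has many Wall matrices, but:

    - products of isometries correspond to block triangular matrices, so that
      determinants multiply ([wall_det_comp]);
    - a Wall matrix of the identity has square determinant
      ([wall_det_id_square]): M = T + T^tr satisfies M T^-1 M = 0, so that
      the skew-symmetric matrix (T - T^tr) / 2 equals (1 - N)^2 T with
      N = M T^-1 / 4 of square zero, and a skew-symmetric determinant is a
      square ([skew_det_square]);
    - the reflection in v has the 1 x 1 Wall matrix b(v, v)
      ([wall_det_reflection]).

    Multiplying by the inverse of a product of reflections, one sees that for
    every such product the determinant of any Wall matrix represents the
    spinor norm. It remains to find a Wall matrix for each
    factor of a Cayley decomposition. Since the two unitary groups agree,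
    h'(v, -) = lam h(v, -) with theta lam = - lam ([same_group_ratio]), so
    s_(v, phi) is the map x |-> x - psi h(v, x) v, where psi = phi lam. For an
    F-basis (e_i) of E, the vectors e_i v and the matrix with entries
    mu(theta e_i * e_j * 2 / psi) form a Wall matrix of it
    ([quasi_reflection_wall_det]). Its determinant times N(phi) is the
    determinant of the matrix with entries mu(theta e_i * e_j * 2 / lam), which
    is skew-symmetric since 2 / lam is negated by theta: so it represents
    the class of N(phi). The same trick shows that norms of non-zero elements
    of E_0 are squares ([field_norm_fixed_square]), hence that the norm map
    on cosets has a single square class as its value.

    Both spinor norms are given by a chosen factorization, so the existence of
    one is needed on each side: products of reflections come from an
    orthogonal basis, whose vectors are fixed one after the other
    ([exists_reflection_product]), and normalized Cayley decompositions from a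
    basis of V_sigma that is triangular for the Wall form
    ([exists_normalized_decomposition]). Both bases are instances of
    [semiorthogonal_basis]. *)

(** * Skew-symmetric determinants *)

Section SkewDet.
Variables (K : fieldType) (two_neq0 : 2%:R != 0 :> K).

Lemma skew_diag0 n (S : 'M[K]_n) i : S^T = - S -> S i i = 0.
Proof.
move=> /matrixP /(_ i i); rewrite !mxE => /eqP.
by rewrite -addr_eq0 -mulr2n -mulr_natl mulf_eq0 (negPf two_neq0) => /eqP.
Qed.

Lemma skew_congr n m (P : 'M[K]_(m, n)) (S : 'M[K]_n) :
  S^T = - S -> (P *m S *m P^T)^T = - (P *m S *m P^T).
Proof. by move=> Sskew; rewrite !trmx_mul trmxK Sskew mulNmx mulmxN mulmxA. Qed.

Lemma skew_inv n (S : 'M[K]_n) :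
  S \in unitmx -> S^T = - S -> (invmx S)^T = - invmx S.
Proof.
move=> uS Sskew; rewrite trmx_inv Sskew.
apply: (can_inj (mulKmx (_ : - S \in unitmx))).
  by rewrite -Sskew unitmx_tr.
by rewrite mulmxV -?Sskew ?unitmx_tr // Sskew mulNmx mulmxN opprK mulmxV.
Qed.

Lemma det_skew2 (J : 'M[K]_2) : J^T = - J -> \det J = J 0 1 ^+ 2.
Proof.
move=> Jskew; have J10 : J 1 0 = - J 0 1.
  by have /matrixP/(_ 0 1) := Jskew; rewrite !mxE.
rewrite (expand_det_row _ 0) !big_ord_recl big_ord0 skew_diag0 // mul0r add0r.
rewrite addr0 /cofactor det_mx11 !mxE.
have -> : lift (lift 0 0) 0 = 0 :> 'I_2 by apply: val_inj.
have -> : lift 0 0 = 1 :> 'I_2 by apply: val_inj.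
by rewrite J10 /= expr1; ring.
Qed.

(** By induction on the size: a non-zero entry in the first row is moved to
    position (0, 1) by a congruence, and the Schur complement of the leading
    2 x 2 block is skew-symmetric again. *)
Lemma skew_det_square n (S : 'M[K]_n) :
  S^T = - S -> exists d, \det S = d ^+ 2.
Proof.
elim/ltn_ind: n S => -[|[|n]] IHn S Sskew.
- by exists 1; rewrite det_mx00 expr1n.
- by exists 0; rewrite det_mx11 skew_diag0 // expr0n.
have [[j Sj]|S0] := pselect (exists j, S ord0 j != 0); last first.
  exists 0; rewrite (expand_det_row _ ord0) big1 ?expr0n // => j _.
  have [->|Sj] := eqVneq (S ord0 j) 0; first by rewrite mul0r.
  by case: S0; exists j.
pose P : 'M[K]_n.+2 := tperm_mx (lift ord0 ord0) j.
pose M : 'M[K]_(2 + n) := P *m S *m P^T.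
have Mskew : M^T = - M by apply: skew_congr.
have -> : \det S = \det M.
  by rewrite /M !det_mulmx det_tr mulrAC -expr2 det_perm -signr_odd /=
     -exprM mulnC exprM sqrrN expr1n expr1n mul1r.
have jN0 : j != ord0 by apply: contraNneq Sj => ->; rewrite skew_diag0.
have [Jskew CE Dskew] : [/\ (ulsubmx M)^T = - ulsubmx M,
    dlsubmx M = - (ursubmx M)^T & (drsubmx M)^T = - drsubmx M].
  split; apply/matrixP => k l; rewrite ?mxE.
  - by have /matrixP/(_ (lshift n k) (lshift n l)) := Mskew; rewrite !mxE.
  - by have /matrixP/(_ (lshift n l) (rshift 2 k)) := Mskew; rewrite !mxE => ->.
  - by have /matrixP/(_ (rshift 2 k) (rshift 2 l)) := Mskew; rewrite !mxE.
have J01 : ulsubmx M 0 1 != 0.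
  do 2!rewrite mxE.
  have -> : lshift n (0 : 'I_2) = ord0 :> 'I_n.+2 by apply: val_inj.
  have -> : lshift n (1 : 'I_2) = lift ord0 ord0 :> 'I_n.+2 by apply: val_inj.
  suff <- : S ord0 j = M ord0 (lift ord0 ord0) by [].
  rewrite /M /P tr_tperm_mx -xcolE -xrowE !mxE tpermL tpermD //.
rewrite -(submxK M); set J := ulsubmx M in Jskew J01 *.
set B := ursubmx M in CE *; set D := drsubmx M in Dskew *; rewrite CE.
have uJ : J \in unitmx by rewrite unitmxE det_skew2 // unitfE expf_neq0.
have [d dE] : exists d, \det (D + B^T *m invmx J *m B) = d ^+ 2.
  apply: IHn; first by rewrite ltnS leqnSn.
  rewrite linearD /= Dskew opprD; congr (_ + _).
  by rewrite -[X in _ *m X]trmxK skew_congr ?skew_inv.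
exists (J 0 1 * d); rewrite exprMn -det_skew2 // -dE -(det_ublock _ B).
rewrite -[LHS]mul1r -[X in X * _ = _](det1 K (2 + n)).
transitivity (\det (block_mx 1%:M 0 (B^T *m invmx J) 1%:M
                    *m block_mx J B (- B^T) D)).
  by rewrite det_mulmx det_lblock !det1 !mul1r.
rewrite mulmx_block !mul1mx !mul0mx !addr0; congr (\det (block_mx _ _ _ _)).
- by rewrite -mulmxA mulVmx // mulmx1 addrN.
- by rewrite addrC.
Qed.
End SkewDet.

(** * Orthogonal bases and Cartan-Dieudonne *)

Section SemiorthogonalBasis.
Variables (K : fieldType) (U : vectType K) (tau : {rmorphism K -> K}).
Variable f : U -> U -> K.
Hypotheses (tauK : involutive tau) (f_lin : forall u, scalar (f u)).
Hypothesis f_semilin :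
  forall k u v w, f (k *: u + v) w = tau k * f u w + f v w.
Variable P : U -> Prop.
Hypothesis P_anisotropic : forall v, P v -> f v v != 0.

Definition nondegenerate_on (W : {vspace U}) : Prop :=
  forall u, u \in W -> (forall w, w \in W -> f u w = 0) -> u = 0.

Hypothesis P_exists : forall W, W != 0%VS -> nondegenerate_on W ->
  exists2 v, v \in W & P v.

(** Gram-Schmidt for a form that need not be reflexive: v is taken as the last
    basis vector and the others in the right orthogonal W' of v inside W. The
    form stays non-degenerate on W', because a vector u of W' orthogonal to W'
    can be corrected by a multiple of v into a vector orthogonal to W. The
    predicate P carries the extra conditions wanted of the basis vectors. *)
Lemma semiorthogonal_basis (W : {vspace U}) : nondegenerate_on W ->
  exists vs, [/\ basis_of W vs, pairwise (fun v w => f w v == 0) vs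
               & forall v, v \in vs -> P v].
Proof.
have [n] := ubnP (\dim W); elim: n W => // n IHn W dimW Wnd.
have [->|W0] := eqVneq W 0%VS.
  by exists [::]; rewrite nil_basis.
have [v vW Pv] := P_exists W0 Wnd; have fv := P_anisotropic Pv.
pose phi : {linear U -> K^o} :=
  HB.pack (f v : U -> K^o) (GRing.isLinear.Build K U K^o *:%R (f v) (f_lin v)).
pose W' := (W :&: lker (linfun phi))%VS.
have memW' x : (x \in W') = (x \in W) && (f v x == 0).
  by rewrite memv_cap memv_ker lfunE.
have f0r u : f u 0 = 0.
  by have := f_lin u (-1) 0 0; rewrite scaler0 addr0 mulN1r addNr.
have fZv k u : f u (k *: v) = k * f u v.
  by have := f_lin u k v 0; rewrite f0r !addr0.
have dxW : directv (W' + <[v]>).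
  apply/directv_addP/eqP; rewrite -subv0; apply/subvP => x.
  rewrite memv_cap memW' => /andP[/andP[_ fvx] /vlineP[k xE]].
  move: fvx; rewrite xE fZv mulf_eq0 (negPf fv) orbF => /eqP->.
  by rewrite scale0r mem0v.
have WE : W = (W' + <[v]>)%VS.
  apply/eqP; rewrite eqEsubv subv_add capvSl -memvE vW !andbT.
  apply/subvP => x xW; pose k := f v x / f v v.
  rewrite -[x](subrK (k *: v)) memv_add ?rpredZ ?memv_line // memW'.
  rewrite rpredB ?rpredZ //=.
  rewrite addrC -scaleNr f_lin.
  by rewrite mulNr divfK // addNr.
have W'nd : nondegenerate_on W'.
  move=> u uW' fu0; move: (uW'); rewrite memW' => /andP[uW fvu].
  pose k := tau (f u v / f v v).
  have ukv w : f (u - k *: v) w = f u w - f u v / f v v * f v w.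
    by rewrite -scaleNr addrC f_semilin addrC rmorphN /= tauK mulNr.
  have /eqP : u - k *: v = 0.
    apply: Wnd; first by rewrite rpredB ?rpredZ.
    move=> w; rewrite {1}WE => /memv_addP[w1 w1W' [w2 /vlineP[l ->] ->]].
    move: (w1W'); rewrite memW' => /andP[_ /eqP fvw1].
    rewrite [w1 + _]addrC f_lin !ukv fvw1 (fu0 _ w1W') mulr0 subr0 divfK //.
    by rewrite subrr mulr0 addr0.
  rewrite subr_eq0 => /eqP uE; move: fvu; rewrite uE fZv mulf_eq0 (negPf fv) orbF.
  by move=> /eqP->; rewrite scale0r.
have [|vs [vsb vs_orth vsP]] := IHn W' _ W'nd.
  rewrite -ltnS (leq_trans _ dimW) // ltnS [in X in (_ < X)%N]WE.
  rewrite (directvP dxW) /= dim_vline -{1}[\dim W']addn0 ltn_add2l.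
  by rewrite (contraNneq _ fv) // => ->; rewrite f0r.
exists (rcons vs v); split.
- rewrite WE -cats1 cat_basis // seq1_basis //.
  by apply: contraNneq fv => ->; rewrite f0r.
- rewrite pairwise_rcons vs_orth andbT; apply/allP=> w /(basis_mem vsb).
  by rewrite memW' => /andP[].
- by move=> w; rewrite mem_rcons inE => /predU1P[->|/vsP].
Qed.
End SemiorthogonalBasis.

Section SymmetricForm.
Variables (K : fieldType) (two_neq0 : 2%:R != 0 :> K) (U : vectType K).
Variable b : U -> U -> K.
Hypotheses (b_lin : forall u, scalar (b u)) (bC : forall u v, b u v = b v u).

Let bDr u v w : b u (v + w) = b u v + b u w.
Proof. by have := b_lin u 1 v w; rewrite scale1r mul1r. Qed.

Let b0r u : b u 0 = 0.
Proof. by apply: (addrI (b u 0)); rewrite -bDr !addr0. Qed.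

Let bZr u k v : b u (k *: v) = k * b u v.
Proof. by have := b_lin u k v 0; rewrite b0r !addr0. Qed.

Let bBr u v w : b u (v - w) = b u v - b u w.
Proof. by rewrite bDr -scaleN1r bZr mulN1r. Qed.

Let b_sumr u n (c : 'cV[K]_n) (a : 'I_n -> U) :
  b u (\sum_i c i 0 *: a i) = \sum_i b u (a i) * c i 0.
Proof.
rewrite (big_morph (b u) (bDr u) (b0r u)).
by apply: eq_bigr => i _; rewrite bZr mulrC.
Qed.

Let bBl u v w : b (v - w) u = b v u - b w u.
Proof. by rewrite bC bBr !(bC u). Qed.

Let bDl u v w : b (v + w) u = b v u + b w u.
Proof. by rewrite bC bDr !(bC u). Qed.

Let bZl u k v : b (k *: v) u = k * b v u.
Proof. by rewrite bC bZr (bC u). Qed.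

Lemma reflection_linear v : linear (reflection b v).
Proof.
move=> k x y; rewrite /reflection b_lin.
have -> : 2%:R * (k * b v x + b v y) / b v v =
    k * (2%:R * b v x / b v v) + 2%:R * b v y / b v v.
  by ring.
by rewrite scalerDl -(scalerA k) opprD addrACA -scalerBr.
Qed.

Lemma reflection_isometry v x y : b v v != 0 ->
  b (reflection b v x) (reflection b v y) = b x y.
Proof.
by move=> bv; rewrite /reflection bBl !bBr !bZl !bZr (bC x v); field.
Qed.

Lemma reflectionK v : b v v != 0 -> involutive (reflection b v).
Proof.
move=> bv x; rewrite {1}/reflection {2}/reflection bBr bZr.
rewrite -[RHS]subr0 /reflection -addrA -opprD -scalerDl.
suff -> : 2%:R * b v x / b v v +
    2%:R * (b v x - 2%:R * b v x / b v v * b v v) / b v v = 0.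
  by rewrite scale0r.
by field.
Qed.

Lemma reflection_orth v x : b v x = 0 -> reflection b v x = x.
Proof. by move=> vx; rewrite /reflection vx mulr0 mul0r scale0r subr0. Qed.

Lemma foldr_reflection_isometry vs x y : all (fun v => b v v != 0) vs ->
  b (foldr (reflection b) x vs) (foldr (reflection b) y vs) = b x y.
Proof.
by elim: vs => //= v vs IH /andP[bv bvs]; rewrite reflection_isometry ?IH.
Qed.

Lemma foldr_reflectionK vs x : all (fun v => b v v != 0) vs ->
  foldr (reflection b) (foldr (reflection b) x vs) (rev vs) = x.
Proof.
elim: vs x => //= v vs IH x /andP[bv bvs].
by rewrite rev_cons -cats1 foldr_cat /= reflectionK // IH.
Qed.

(** If u - e is anisotropic, its reflection sends u to e. Otherwise u + e is
    anisotropic, as the values at u - e and u + e add up to 4 b(e, e), and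
    u |-> - e |-> e under the reflections in u + e and in e. *)
Lemma reflections_move u e : b u u = b e e -> b e e != 0 ->
  exists ws, [/\ all (fun v => b v v != 0) ws,
    foldr (reflection b) u ws = e
    & forall x, b u x = 0 -> b e x = 0 -> foldr (reflection b) x ws = x].
Proof.
move=> ue bee.
have beE : b (u - e) (u - e) = 2%:R * (b e e - b u e).
  by rewrite !bBl !bBr (bC e u) ue; ring.
have [be|be] := eqVneq (b (u - e) (u - e)) 0; last first.
  exists [:: u - e]; split; rewrite /= ?be //.
    by rewrite /reflection beE bBl ue (bC e u) divff -?beE // scale1r subKr.
  by move=> x ux ex; rewrite reflection_orth // bBl ux ex subrr.
have bue : b u e = b e e.
  move/eqP: be; rewrite beE mulf_eq0 (negPf two_neq0) subr_eq0.
  by move/eqP.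
have bpE : b (u + e) (u + e) = 2%:R * (2%:R * b e e).
  by rewrite !bDl !bDr (bC e u) ue bue; ring.
have bp : b (u + e) (u + e) != 0 by rewrite bpE !mulf_neq0.
exists [:: e; u + e]; split; rewrite /= ?bp ?bee //.
  have -> : reflection b (u + e) u = - e.
    rewrite /reflection bpE bDl ue (bC e u) bue.
    have -> : 2%:R * (b e e + b e e) / (2%:R * (2%:R * b e e)) = 1.
      by field; rewrite two_neq0 bee.
    by rewrite scale1r opprD addrA subrr add0r.
  rewrite /reflection -scaleN1r bZr (_ : _ / _ = - 2%:R); last by field.
  by rewrite -scalerBl -[RHS]scale1r; congr (_ *: _); ring.
move=> x ux ex; rewrite (@reflection_orth (u + e)) ?reflection_orth //.
by rewrite bDl ux ex addr0.
Qed.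

Lemma reflections_fix (g : U -> U) es : (forall x y, b (g x) (g y) = b x y) ->
  pairwise (fun v w => b w v == 0) es -> all (fun v => b v v != 0) es ->
  exists2 ws, all (fun v => b v v != 0) ws
    & forall e, e \in es -> foldr (reflection b) (g e) ws = e.
Proof.
move=> gb; elim: es => [|e es IH] /=; first by exists [::].
move=> /andP[/allP e_es es_orth] /andP[be bes].
have [ws bws wsE] := IH es_orth bes.
pose g' x := foldr (reflection b) (g x) ws.
have g'b x y : b (g' x) (g' y) = b x y by rewrite foldr_reflection_isometry.
have [ws' [bws' ws'e ws'fix]] := reflections_move (g'b e e) be.
exists (ws' ++ ws); first by rewrite all_cat bws' bws.
move=> x; rewrite inE foldr_cat => /predU1P[->|xes]; first exact: ws'e.
have ex : b e x = 0 by rewrite bC; apply/eqP/e_es.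
rewrite wsE // ws'fix // -[in X in b _ X](wsE x xes) -/(g' x).
by rewrite g'b.
Qed.

Lemma exists_orthogonal_basis : (forall x, (forall y, b x y = 0) -> x = 0) ->
  exists es, [/\ basis_of fullv es, pairwise (fun v w => b w v == 0) es
               & all (fun v => b v v != 0) es].
Proof.
move=> b_nd.
have [||||es [esb es_orth esP]] := @semiorthogonal_basis K U idfun b _ b_lin _
    (fun v => b v v != 0) (fun _ => id) _ fullv.
- by [].
- by move=> k u v w; rewrite bDl bZl.
- move=> W W0 Wnd; apply: contrapT => noP; move/negP: W0; apply.
  rewrite -subv0; apply/subvP => u uW; rewrite memv0; apply/eqP/Wnd => // w wW.
  have iso v : v \in W -> b v v = 0.
    by move=> vW; apply/eqP; apply: contrapT => /negP bv; apply: noP; exists v.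
  have := iso _ (rpredD uW wW); rewrite bDl !bDr !iso // add0r addr0 (bC w).
  by move/eqP; rewrite -mulr2n -mulr_natl mulf_eq0 (negPf two_neq0) => /eqP.
- by move=> u _ bu0; apply: b_nd => y; apply: bu0; rewrite memvf.
- by exists es; split=> //; apply/allP.
Qed.

(** A weak Cartan-Dieudonne theorem, without bound on the number of factors. *)
Lemma exists_reflection_product (g : 'End(U)) :
  (forall x, (forall y, b x y = 0) -> x = 0) ->
  (forall x y, b (g x) (g y) = b x y) ->
  exists vs, reflection_product b g vs.
Proof.
move=> b_nd gb; have [es [esb es_orth bes]] := exists_orthogonal_basis b_nd.
have [ws bws wsE] := reflections_fix gb es_orth bes.
exists (rev ws); split; first by rewrite all_rev.
have fix_lin : linear (fun x => foldr (reflection b) x (rev ws)).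
  by elim: (rev ws) => //= v vs IH k x y; rewrite IH reflection_linear.
pose phi : {linear U -> U} := HB.pack (fun x => foldr (reflection b) x (rev ws))
  (GRing.isLinear.Build K U U *:%R _ fix_lin).
suff -> : g = linfun phi by move=> x; rewrite lfunE.
apply/(fullv_lfunP _ _ (span_basis esb)) => e ees.
by rewrite lfunE /= -[in RHS](wsE e ees) foldr_reflectionK.
Qed.

(** * Wall matrices and the spinor norm *)

(** The column c is T^-1 A' x in the notation of the introduction. With the
    factor 2, the reflection in v gets the determinant b(v, v) itself rather
    than its half. *)
Definition wall_matrix (g : U -> U) n (a : 'I_n -> U) (T : 'M[K]_n) : Prop :=
  [/\ T \in unitmx,
      T + T^T = \matrix_(i, j) (2%:R * b (a i) (a j))
    & forall x, exists2 c : 'cV[K]_n,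
        T *m c = \col_i (2%:R * b (a i) x)
      & g x = x - \sum_i c i 0 *: a i].

Definition has_wall_det (g : U -> U) (d : K) : Prop :=
  exists n (a : 'I_n -> U) (T : 'M[K]_n), wall_matrix g a T /\ \det T = d.

Lemma wall_det_id : has_wall_det id 1.
Proof.
exists 0, (fun=> 0), 1%:M; split; last by rewrite det1.
split; first exact: unitmx1.
- by apply/matrixP => -[].
- by move=> x; exists 0; [apply/matrixP => -[] | rewrite big_ord0 subr0].
Qed.

Lemma wall_det_reflection v : b v v != 0 -> has_wall_det (reflection b v) (b v v).
Proof.
move=> bv; exists 1, (fun=> v), (b v v)%:M; split; last by rewrite det_scalar1.
split; first by rewrite unitmxE det_scalar1 unitfE.
- by apply/matrixP=> i j; rewrite !ord1 !mxE mulr1n mulr_natl mulr2n.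
- move=> x; exists (const_mx (2%:R * b v x / b v v)).
    apply/matrixP=> i j; rewrite !ord1 mul_scalar_mx !mxE.
    by rewrite mulrC divfK.
  by rewrite big_ord_recl big_ord0 addr0 mxE.
Qed.

(** The Wall matrix of a product is block upper triangular; the corner is
    forced by the condition on T + T^tr. *)
Lemma wall_det_comp g1 g2 d1 d2 :
  has_wall_det g1 d1 -> has_wall_det g2 d2 ->
  has_wall_det (g1 \o g2) (d1 * d2).
Proof.
move=> [n1 [a1 [T1 [[uT1 TT1 g1E] <-]]]] [n2 [a2 [T2 [[uT2 TT2 g2E] <-]]]].
pose X : 'M_(n1, n2) := \matrix_(i, j) (2%:R * b (a1 i) (a2 j)).
pose a (k : 'I_(n1 + n2)) := match split k with inl i => a1 i | inr j => a2 j end.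
have al i : a (lshift n2 i) = a1 i by rewrite /a (unsplitK (inl i) : split _ = _).
have ar i : a (rshift n1 i) = a2 i by rewrite /a (unsplitK (inr i) : split _ = _).
exists (n1 + n2)%N, a, (block_mx T1 X 0 T2); split; last by rewrite det_ublock.
split.
- by rewrite unitmxE det_ublock unitrM -!unitmxE uT1.
- rewrite tr_block_mx add_block_mx TT1 TT2 trmx0 addr0 add0r.
  apply/matrixP => i j; rewrite -[i]splitK -[j]splitK.
  case: (split i) => k; case: (split j) => l /=;
    rewrite ?block_mxEul ?block_mxEur ?block_mxEdl ?block_mxEdr !mxE ?al ?ar //.
  by rewrite bC.
- move=> x; have [c2 Tc2 g2x] := g2E x; have [c1 Tc1 g1x] := g1E (g2 x).
  exists (col_mx c1 c2).
    rewrite mul_block_col mul0mx add0r Tc1 Tc2 -[RHS]vsubmxK.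
    congr col_mx; apply/colP=> i; rewrite !mxE ?al ?ar //.
    rewrite g2x bBr b_sumr mulrBr mulr_sumr -[RHS](subrK (\sum_j X i j * c2 j 0)).
    by congr (_ - _ + _); apply: eq_bigr => j _; rewrite mxE mulrA.
  rewrite /= g1x g2x big_split_ord /= opprD addrA addrAC; congr (_ - _ - _);
    by apply: eq_bigr => i _; rewrite ?al ?ar ?col_mxEu ?col_mxEd.
Qed.

(** This is why the spinor norm is well defined: N = M T^-1 / 4 has square zero
    when g is the identity, so T is (T - T^tr) / 2 up to the square of the
    invertible matrix 1 - N. *)
Lemma wall_det_id_square d :
  has_wall_det id d -> exists2 e, e != 0 & d = e ^+ 2.
Proof.
move=> [n [a [T [[uT TT idE] <-]]]].
set M := T + T^T in TT.
(* As A T^-1 A' = 0 and M = A' A, this is A' (A T^-1 A') A. *)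
have MTM : M *m invmx T *m M = 0.
  apply/matrixP => k l; have [c Tc /esym/eqP] := idE (a l).
  rewrite -subr_eq0 addrAC subrr add0r oppr_eq0 => /eqP ca0.
  rewrite -mulmxA !mxE.
  have cE i : (invmx T *m M) i l = c i 0.
    have -> : c = invmx T *m col l M.
      rewrite -[c](mulKmx uT) Tc; congr (_ *m _).
      by apply/colP => j; rewrite TT !mxE.
    by rewrite colE mulmxA -colE [RHS]mxE.
  transitivity (2%:R * b (a k) (\sum_i c i 0 *: a i)).
    rewrite b_sumr mulr_sumr; apply: eq_bigr => i _.
    by rewrite cE TT mxE mulrA.
  by rewrite ca0 b0r mulr0.
pose N := 4%:R^-1 *: (M *m invmx T).
have four_neq0 : 4%:R != 0 :> K by rewrite (natrM _ 2 2) mulf_neq0.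
have NN : N *m N = 0.
  by rewrite -scalemxAl -scalemxAr mulmxA MTM mul0mx !scaler0.
have Q1 : (1%:M - N) *m (1%:M + N) = 1%:M.
  by rewrite mulmxDr mulmx1 mulmxBl mul1mx NN subr0 subrK.
have detQ : \det (1%:M - N) != 0.
  apply: contraTneq (oner_neq0 K) => Q0.
  by rewrite -(det1 K n) -Q1 det_mulmx Q0 mul0r eqxx.
pose S := (1%:M - N) *m (1%:M - N) *m T.
have SE : S = 2%:R^-1 *: (T - T^T).
  have -> : S = (1%:M - (N + N)) *m T.
    by rewrite /S mulmxBr mulmx1 [X in _ - X]mulmxBl mul1mx NN subr0 -addrA -opprD.
  rewrite mulmxBl mul1mx -scalerDl -scalemxAl mulmxKV //.
  have -> : 4%:R^-1 + 4%:R^-1 = 2%:R^-1 :> K.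
    by field; rewrite two_neq0.
  rewrite /M scalerDr opprD addrA scalerBr; congr (_ - _).
  rewrite -{1}[T]scale1r -scalerBl; congr (_ *: _).
  by field; rewrite two_neq0.
have [|e eE] := @skew_det_square K two_neq0 n S.
  by rewrite SE linearZ /= linearB /= trmxK -scalerN opprB.
exists (e / \det (1%:M - N)).
  rewrite mulf_neq0 ?invr_neq0 // -sqrf_eq0 -eE !det_mulmx !mulf_neq0 //.
  by rewrite -unitfE -unitmxE.
rewrite expr_div_n -eE !det_mulmx expr2; field.
exact: detQ.
Qed.

(** The Wall determinant of a quasi-reflection is N(phi) only up to squares. *)
Definition has_wall_disc (g : U -> U) (d : K) : Prop :=
  exists2 t, t != 0 & has_wall_det g (d * t ^+ 2).

Lemma wall_disc_foldr (I : eqType) (s : seq I) (r : I -> U -> U) (d : I -> K) :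
  (forall i, i \in s -> has_wall_disc (r i) (d i)) ->
  has_wall_disc (fun x => foldr r x s) (\prod_(i <- s) d i).
Proof.
elim: s => [|i s IH] rd.
  by exists 1; rewrite ?oner_neq0 // big_nil expr1n mulr1; apply: wall_det_id.
have [t t0 rt] := rd i (mem_head _ _).
have [|t' t'0 rt'] := IH; first by move=> j js; apply: rd; rewrite inE js orbT.
exists (t * t'); first by rewrite mulf_neq0.
by rewrite big_cons exprMn mulrACA; apply: (wall_det_comp rt rt').
Qed.

End SymmetricForm.

(** * Norms and the forms mu (theta x * y * z) *)

Section FieldNorm.
Variables (F : fieldType) (E : fieldExtType F).
Local Notation e := (vbasis {:E}).

Lemma field_norm1 : field_norm (1 : E) = 1.
Proof.
by rewrite /field_norm amull1 passmx.mxof1 ?det1 // (basis_free (vbasisP _)).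
Qed.

Lemma field_normM (x y : E) : field_norm (x * y) = field_norm x * field_norm y.
Proof.
by rewrite /field_norm amullM (passmx.mxof_comp _ _ (vbasisP _)) det_mulmx mulrC.
Qed.

Lemma field_norm_neq0 (x : E) : x != 0 -> field_norm x != 0.
Proof.
move=> x0; apply: contraNneq (oner_neq0 F) => Nx0.
by rewrite -field_norm1 -(mulfV x0) field_normM Nx0 mul0r.
Qed.

Lemma field_norm_prod (I : Type) (s : seq I) (f : I -> E) :
  field_norm (\prod_(i <- s) f i) = \prod_(i <- s) field_norm (f i).
Proof. exact: (big_morph _ field_normM field_norm1). Qed.

Lemma amull_mxE (x : E) i j :
  passmx.mxof e e (amull x) i j = coord e j (x * e`_i).
Proof.
have -> : x * e`_i = amull x e`_i by rewrite lfunE.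
rewrite passmx.coord_rVof (passmx.rVof_app _ (vbasisP _)) passmx.rVofE ?vbasisP //.
by rewrite -rowE [RHS]mxE.
Qed.

End FieldNorm.

Section TraceForm.
Variables (F : fieldType) (E : fieldExtType F) (theta : 'AEnd(E)).
Hypotheses (two_neq0 : 2%:R != 0 :> F) (thetaK : involutive theta).
Variable mu : E -> F.
Hypotheses (mu_lin : scalar mu) (mu_theta : forall x, mu (theta x) = mu x).
Hypothesis mu_neq0 : exists x, mu x != 0.

Local Notation e := (vbasis {:E}).

Let muD x y : mu (x + y) = mu x + mu y.
Proof. by have := mu_lin 1 x y; rewrite scale1r mul1r. Qed.

Let mu0 : mu 0 = 0.
Proof. by apply: (addrI (mu 0)); rewrite -muD !addr0. Qed.

Let muZ k x : mu (k *: x) = k * mu x.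
Proof. by have := mu_lin k x 0; rewrite mu0 !addr0. Qed.

(** Its determinant depends on z through the norm ([det_gram_mxM]), and it is
    skew-symmetric when z is negated by theta. *)
Definition gram_mx (z : E) : 'M[F]_(\dim {:E}) :=
  \matrix_(i, j) mu (theta e`_i * e`_j * z).

Lemma gram_mx_coord z y i :
  \sum_j gram_mx z i j * coord e j y = mu (theta e`_i * y * z).
Proof.
rewrite {2}(coord_vbasis (memvf y)) mulr_sumr mulr_suml (big_morph mu muD mu0).
by apply: eq_bigr => j _; rewrite mxE mulrC -muZ -scalerAr -scalerAl.
Qed.

Lemma det_gram_mxM z y : \det (gram_mx (z * y)) = \det (gram_mx z) * field_norm y.
Proof.
rewrite /field_norm -(det_tr (passmx.mxof _ _ _)) -det_mulmx; congr (\det _).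
apply/matrixP => i j; rewrite [LHS]mxE [RHS]mxE.
have -> : theta e`_i * e`_j * (z * y) = theta e`_i * (y * e`_j) * z by ring.
rewrite -gram_mx_coord; apply: eq_bigr => k _.
by rewrite [(passmx.mxof _ _ _)^T _ _]mxE amull_mxE.
Qed.

Lemma gram_mx_tr z : (gram_mx z)^T = gram_mx (theta z).
Proof.
apply/matrixP => i j; rewrite !mxE -mu_theta !rmorphM /= thetaK.
by congr (mu (_ * _)); rewrite mulrC.
Qed.

Lemma gram_mxD y z : gram_mx (y + z) = gram_mx y + gram_mx z.
Proof. by apply/matrixP=> i j; rewrite !mxE mulrDr muD. Qed.

Lemma det_gram_mx_neq0 z : z != 0 -> \det (gram_mx z) != 0.
Proof.
move=> z0; apply/det0P => -[u u0 uG]; case/negP: u0.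
pose w := \sum_i u 0 i *: e`_i.
have muw (j : 'I_(\dim {:E})) : mu (theta w * e`_j * z) = 0.
  have /rowP/(_ j) := uG; rewrite !mxE => <-.
  rewrite /w linear_sum /= !mulr_suml (big_morph mu muD mu0).
  by apply: eq_bigr => i _; rewrite mxE linearZ /= -!scalerAl muZ.
have muwx x : mu (theta w * x * z) = 0.
  rewrite (coord_vbasis (memvf x)) mulr_sumr mulr_suml (big_morph mu muD mu0).
  by rewrite big1 // => i _; rewrite -scalerAr -scalerAl muZ muw mulr0.
have w0 : w = 0.
  have [x /negP mux] := mu_neq0.
  apply/eqP; rewrite -(fmorph_eq0 theta); apply: contrapT => /negP w0; apply: mux.
  have -> : x = theta w * (x / (theta w * z)) * z by field; rewrite w0 z0.
  by rewrite muwx.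
apply/eqP/rowP => i; rewrite mxE.
rewrite -[LHS](coord_sum_free (fun i => u 0 i) _ (basis_free (vbasisP _))).
by rewrite -/w w0 linear0.
Qed.

Lemma det_gram_mx_square z : z != 0 -> theta z = - z ->
  exists2 t, t != 0 & \det (gram_mx z) = t ^+ 2.
Proof.
move=> z0 zN; have [|t tE] := @skew_det_square F two_neq0 _ (gram_mx z).
  rewrite gram_mx_tr zN; apply/matrixP => i j; rewrite !mxE mulrN.
  by rewrite -scaleN1r muZ mulN1r.
by exists t => //; rewrite -sqrf_eq0 -tE det_gram_mx_neq0.
Qed.

Hypothesis theta_neq1 : exists x, theta x != x.

Lemma exists_skew_elt : exists2 z, z != 0 & theta z = - z.
Proof.
have [x xN] := theta_neq1; exists (theta x - x); first by rewrite subr_eq0.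
by rewrite rmorphB /= thetaK opprB.
Qed.

(** If theta z = - z, then theta (z x) = - (z x) too, and N(x) is the quotient of
    two non-zero skew-symmetric determinants. *)
Lemma field_norm_fixed_square x : x != 0 -> theta x = x ->
  exists2 t, t != 0 & field_norm x = t ^+ 2.
Proof.
move=> x0 xfix; have [z z0 zN] := exists_skew_elt.
have [t t0 tE] := det_gram_mx_square z0 zN.
have [||s s0 sE] := @det_gram_mx_square (z * x).
- by rewrite mulf_neq0.
- by rewrite rmorphM /= xfix zN mulNr.
exists (s / t); first by rewrite mulf_neq0 ?invr_neq0.
have := det_gram_mxM z x; rewrite sE tE => sE'.
by rewrite expr_div_n sE' mulrC mulKf // expf_neq0.
Qed.

End TraceForm.

(** * Hermitian and anti-hermitian forms with the same unitary group *)

Section Sesquilinear.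
Variables (F : fieldType) (E : fieldExtType F) (theta : 'AEnd(E)).
Variables (V : vectType E) (h : sesquilinear_form theta V).
Hypotheses (two_neq0 : 2%:R != 0 :> F) (thetaK : involutive theta).
Hypothesis theta_neq1 : exists x, theta x != x.

Lemma formDr x y z : h x (y + z) = h x y + h x z.
Proof. exact: linearDr. Qed.
Lemma formBr x y z : h x (y - z) = h x y - h x z.
Proof. exact: linearBr. Qed.
Lemma formZr k x y : h x (k *: y) = k * h x y.
Proof. exact: linearZr_LR. Qed.
Lemma formDl x y z : h (x + y) z = h x z + h y z.
Proof. exact: linearDl. Qed.
Lemma formBl x y z : h (x - y) z = h x z - h y z.
Proof. exact: linearBl. Qed.
Lemma formZl k x y : h (k *: x) y = theta k * h x y.
Proof. exact: linearZl_LR. Qed.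
Lemma form0r x : h x 0 = 0.
Proof. exact: linear0r. Qed.
Lemma form0l x : h 0 x = 0.
Proof. exact: linear0l. Qed.

Lemma form_lin x : scalar (h x).
Proof. by move=> k y z; rewrite formDr formZr. Qed.

Lemma two_ext_neq0 : 2%:R != 0 :> E.
Proof. by rewrite -(rmorph_nat (in_alg E)) fmorph_eq0. Qed.

Lemma quasi_reflection_linear p : linear (quasi_reflection h p).
Proof.
move=> k x y; rewrite /quasi_reflection formDr formZr scalerBr scalerA.
by rewrite mulrDr scalerDl opprD addrACA mulrCA.
Qed.

Lemma quasi_reflection_isometry eps p x y :
  (forall x y, h y x = eps * theta (h x y)) ->
  p.2 != 0 -> p.2^-1 + eps * theta p.2^-1 = h p.1 p.1 ->
  h (quasi_reflection h p x) (quasi_reflection h p y) = h x y.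
Proof.
case: p => v phi /= hC phi0 phiE; rewrite /quasi_reflection /=.
rewrite formBl !formBr !formZl !formZr -phiE (hC v x) !rmorphM fmorphV /=.
field.
by rewrite phi0 fmorph_eq0 phi0.
Qed.

Lemma isometry_inj (g : 'End(V)) : nondegenerate_form h ->
  (forall x y, h (g x) (g y) = h x y) -> lker g == 0%VS.
Proof.
move=> h_nd gh; apply/lker0P => x y gxy; apply/eqP; rewrite -subr_eq0; apply/eqP.
by apply: h_nd => z; rewrite -gh linearB /= gxy subrr form0l.
Qed.

(** This provides a quasi-reflection of a hermitian form along any given
    non-zero vector. *)
Lemma exists_hermitian_half (d : E) : theta d = d ->
  exists2 psi, psi != 0 & psi^-1 + theta psi^-1 = d.
Proof.
move=> dfix; have [->|d0] := eqVneq d 0.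
  have [z z0 zN] := exists_skew_elt thetaK theta_neq1.
  by exists z^-1; rewrite ?invr_neq0 // invrK zN subrr.
exists (2%:R / d); first by rewrite mulf_neq0 ?invr_neq0 ?two_ext_neq0.
rewrite invf_div rmorphM fmorphV /= dfix rmorph_nat.
by field; rewrite two_ext_neq0.
Qed.

End Sesquilinear.

Section SameUnitaryGroup.
Variables (F : fieldType) (E : fieldExtType F) (theta : 'AEnd(E)).
Variables (V : vectType E) (h h' : sesquilinear_form theta V).
Hypotheses (two_neq0 : 2%:R != 0 :> F) (thetaK : involutive theta).
Hypothesis theta_neq1 : exists x, theta x != x.
Hypotheses (h_herm : hermitian_form h) (h_nd : nondegenerate_form h).
Hypotheses (h'_anti : antihermitian_form h') (h'_nd : nondegenerate_form h').
Hypothesis same_group : isometry_group h' = isometry_group h.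

(** For a quasi-reflection s of h along v, which preserves h' as well, and x
    orthogonal to v for h, comparing h'(s x, s y) with h'(x, y) gives
    h'(x, v) = 0 since s fixes x. *)
Lemma same_group_orth v x : h v x = 0 -> h' v x = 0.
Proof.
move=> hvx; have [->|v0] := eqVneq v 0; first exact: form0l.
have [y hvy] : exists y, h v y != 0.
  apply: contrapT => hv; case/eqP: v0; apply: h_nd => y; apply/eqP.
  by apply: contrapT => /negP hvy; apply: hv; exists y.
have [psi psi0 psiE] :=
  exists_hermitian_half two_neq0 thetaK theta_neq1 (esym (h_herm v v)).
pose phi : {linear V -> V} := HB.pack (quasi_reflection h (v, psi))
  (GRing.isLinear.Build E V V *:%R _ (quasi_reflection_linear h (v, psi))).
have phi_iso a b : h (phi a) (phi b) = h a b.
  apply: (@quasi_reflection_isometry _ _ _ _ h 1) => //=.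
    by move=> a' b'; rewrite mul1r h_herm.
  by rewrite mul1r.
have : isometry_group h' (linfun phi).
  rewrite same_group; split; last by move=> a b; rewrite !lfunE phi_iso.
  by apply: (isometry_inj h_nd) => a b; rewrite !lfunE phi_iso.
case=> _ /(_ x y); rewrite !lfunE /= /quasi_reflection /= hvx mulr0 scale0r subr0.
rewrite formBr formZr => /eqP; rewrite -subr_eq0 addrAC subrr add0r oppr_eq0.
rewrite !mulf_eq0 (negPf psi0) (negPf hvy) /= => /eqP h'xv.
by rewrite h'_anti h'xv rmorph0 oppr0.
Qed.

(** The factor lam(u) with h'(u, -) = lam(u) h(u, -) satisfies
    lam(w) = - theta (lam(u)) whenever h(u, w) is non-zero. It is therefore
    skew at anisotropic vectors, and equal at v and at an anisotropic w not
    orthogonal to v. *)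
Lemma same_group_ratio v : v != 0 ->
  exists lam, [/\ lam != 0, theta lam = - lam & forall x, h' v x = lam * h v x].
Proof.
have ratio u y : h u y != 0 -> forall x, h' u x = h' u y / h u y * h u x.
  move=> huy x; apply/eqP; rewrite -subr_eq0 mulrAC -mulrA mulrC -formZr -formBr.
  apply/eqP/same_group_orth; rewrite formBr formZr.
  by rewrite divfK ?subrr.
have nd_sep g : nondegenerate_form g ->
    forall u : V, u != 0 -> exists y, g u y != 0 :> E.
  move=> g_nd u u0; apply: contrapT => gu; case/eqP: u0; apply: g_nd => y.
  by apply/eqP; apply: contrapT => /negP guy; apply: gu; exists y.
move=> v0; have [w hvw hww] : exists2 w, h v w != 0 & h w w != 0.
  have [w hvw] := nd_sep _ h_nd _ v0.
  have [hvv|hvv] := eqVneq (h v v) 0; last by exists v.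
  have [hww|hww] := eqVneq (h w w) 0; last by exists w.
  (* h(v, v) = h(w, w) = 0, so h(w', w') = 1 + 1. *)
  pose w' := w + (h w v)^-1 *: v.
  exists w'; rewrite /w' ?formDr ?formZr ?formDl ?formZl hvv ?mulr0 ?addr0 //.
  have hwv : h w v != 0 by rewrite h_herm fmorph_eq0.
  by rewrite hww add0r mulVf // fmorphV /= -h_herm mulVf // two_ext_neq0.
have ratioC u y : h u y != 0 -> h' y u / h y u = - theta (h' u y / h u y).
  by move=> huy; rewrite h'_anti h_herm rmorphM fmorphV mulNr.
pose lam := h' w w / h w w.
have lamN : theta lam = - lam by rewrite {2}/lam (ratioC _ _ hww) opprK.
have hwv : h w v != 0 by rewrite h_herm fmorph_eq0.
have lamE : h' v w / h v w = lam.
  by rewrite ratioC // (ratio w w hww v) mulfK // lamN opprK.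
exists lam; split=> // [|x]; last by rewrite -lamE; apply: ratio.
apply: contraNneq v0 => lam0; apply/eqP/h'_nd => x.
by rewrite (ratio v w hvw) lamE lam0 mul0r.
Qed.

End SameUnitaryGroup.

(** * Existence of normalized Cayley decompositions *)

Lemma span_closed (K : fieldType) (U : vectType K) (Q : U -> Prop) (vs : seq U) :
  Q 0 -> (forall k u v, Q u -> Q v -> Q (k *: u + v)) ->
  (forall u, u \in vs -> Q u) -> forall u, u \in <<vs>>%VS -> Q u.
Proof.
move=> Q0 Qlin; elim: vs => [|v vs IH] Qvs u.
  by rewrite span_nil memv0 => /eqP->.
rewrite span_cons => /memv_addP[_ /vlineP[k ->] [w wvs ->]].
apply: Qlin; first by apply: Qvs; rewrite mem_head.
by apply: IH wvs => w' w'vs; apply: Qvs; rewrite inE w'vs orbT.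
Qed.

Section Cayley.
Variables (F : fieldType) (E : fieldExtType F) (theta : 'AEnd(E)).
Variables (V : vectType E) (h : sesquilinear_form theta V).
Hypotheses (thetaK : involutive theta) (theta_neq1 : exists x, theta x != x).
Hypotheses (h_anti : antihermitian_form h) (h_nd : nondegenerate_form h).
Variable sigma : 'End(V).
Hypothesis sigma_unitary : isometry_group h sigma.

Local Notation D := (\1%VF - sigma).
Local Notation f := (wall_form h sigma).

Let sigmaE x y : h (sigma x) (sigma y) = h x y.
Proof. by case: sigma_unitary. Qed.

Let DE x : D x = x - sigma x.
Proof. by rewrite add_lfunE opp_lfunE id_lfunE. Qed.

(** Independence of the preimage: h (v - sigma v, x) vanishes for x fixed by
    sigma. *)
Lemma wall_formE u x : u \in limg D -> f u (x - sigma x) = h u x.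
Proof.
move=> /memv_imgP[z _ ->]; rewrite /wall_form.
set y := (_ - _)^-1%VF _.
have yx : y - sigma y = x - sigma x.
  by rewrite -!DE limg_lfunVK ?DE -?DE ?memv_img ?memvf.
apply/eqP; rewrite -subr_eq0 -formBr DE formBl -(sigmaE z (y - x)) linearB /=.
suff -> : sigma y - sigma x = y - x by rewrite subrr.
have -> : sigma y = y - (x - sigma x) by rewrite -yx subKr.
by rewrite -addrA -opprD subrK.
Qed.

Lemma wall_form_lin u : scalar (f u).
Proof. by move=> k x y; rewrite /wall_form linearP formDr formZr. Qed.

Lemma wall_form_semilin k u v w : f (k *: u + v) w = theta k * f u w + f v w.
Proof. by rewrite /wall_form formDl formZl. Qed.

(** On the diagonal, this is the equation satisfied by the inverse of the second
    component of a quasi-reflection; off the diagonal, it determines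
    f(v, w) from h(v, w) when f(w, v) = 0. *)
Lemma wall_form_skew u w : u \in limg D -> w \in limg D ->
  f u w - theta (f w u) = h u w.
Proof.
move=> uD wD; have /memv_imgP[x _ uE] := uD; have /memv_imgP[y _ wE] := wD.
rewrite {1}wE {2}uE !DE !wall_formE // (h_anti x w) rmorphN /= thetaK opprK.
rewrite uE wE !DE !formBl !formBr sigmaE; ring.
Qed.

Lemma wall_form_nondeg : nondegenerate_on f (limg D).
Proof.
move=> u uD fu; apply: h_nd => x; rewrite -wall_formE //.
by apply: fu; rewrite -DE memv_img ?memvf.
Qed.

Lemma wall_form_nondeg_r w : w \in limg D ->
  (forall u, u \in limg D -> f u w = 0) -> w = 0.
Proof.
move=> /memv_imgP[t _ ->]; rewrite DE => ft.
have ht x : h (x - sigma x) t = 0.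
  have xD : x - sigma x \in limg D by rewrite -DE memv_img ?memvf.
  by rewrite -wall_formE // ft.
case: sigma_unitary => /lker0_lfunVK sigmaVK _.
apply: h_nd => x; rewrite h_anti -[x]sigmaVK formBr sigmaE.
set z := _ x; have /eqP := ht z; rewrite formBl subr_eq0 => /eqP->.
by rewrite subrr rmorph0 oppr0.
Qed.

(** The displacement y of x under the product solves the triangular system
    f(u, y) = h(u, x), for u among the vs. When the vs span V_sigma, the
    displacement x - sigma x solves it too. *)
Lemma cayley_product vs x :
  (forall v, v \in vs -> v \in limg D /\ f v v != 0) ->
  pairwise (fun v w => f w v == 0) vs ->
  let y := x - foldr (quasi_reflection h) x [seq (v, (f v v)^-1) | v <- vs] in
  y \in <<vs>>%VS /\ forall u, u \in vs -> f u y = h u x.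
Proof.
elim: vs => [|v vs IH] /= vsD; first by rewrite subrr mem0v.
move=> /andP[/allP v_vs vs_orth].
have [|/=] := IH _ vs_orth.
  by move=> w wvs; apply: vsD; rewrite inE wvs orbT.
set x1 := foldr _ _ _; set y' := x - x1 => y'vs y'E.
have [vD fv] := vsD v (mem_head _ _).
have -> : x - quasi_reflection h (v, (f v v)^-1) x1 =
    ((f v v)^-1 * h v x1) *: v + y'.
  by rewrite /quasi_reflection /= opprB addrCA.
set k := _ * _; split.
  by rewrite span_cons memv_add // rpredZ // memv_line.
move=> u; rewrite inE wall_form_lin => /predU1P[->|uvs].
  have y'D : y' \in limg D.
    apply: subvP y'vs; apply/span_subvP => w wvs.
    by have [] : w \in limg D /\ f w w != 0 by apply: vsD; rewrite inE wvs orbT.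
  have fy'v : f y' v = 0.
    apply: (@span_closed _ _ (fun u => f u v = 0)) y'vs.
    - exact: form0l.
    - by move=> l a b av bv; rewrite wall_form_semilin av bv mulr0 addr0.
    - by move=> w /v_vs /eqP.
  have := wall_form_skew vD y'D; rewrite fy'v rmorph0 subr0 => ->.
  by rewrite /k mulrAC mulVf // mul1r -formDr addrC subrK.
by rewrite (eqP (v_vs u uvs)) mulr0 add0r y'E.
Qed.

(** A semi-orthogonal basis of V_sigma for f, with phi = f(v, v)^-1. Vectors
    with f(v, v) non-zero exist: an alternating form is anti-symmetric, and a
    sesquilinear one with theta non-trivial is then zero. Rescaling v keeps
    f(v, v) non-zero and normalizes h(a, v). *)
Lemma exists_normalized_decomposition a :
  exists ps, normalized_decomposition h a sigma ps.
Proof.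
pose P v := f v v != 0 /\ ((h a v == 0) || (h a v == 1)).
have [|||vs [vsb vs_orth vsP]] := @semiorthogonal_basis E V theta f thetaK
  wall_form_lin wall_form_semilin P _ _ (limg D).
- by move=> v [].
- move=> W W0 Wnd.
  have [v vW fv] : exists2 v, v \in W & f v v != 0.
    apply: contrapT => noP; move/negP: W0; apply.
    rewrite -subv0; apply/subvP => u uW; rewrite memv0; apply/eqP/Wnd => // w wW.
    have alt u' : u' \in W -> f u' w = - f w u'.
      have iso v : v \in W -> f v v = 0.
        by move=> vW; apply/eqP; apply: contrapT => /negP fv; apply: noP; exists v.
      move=> u'W; have := iso _ (rpredD u'W wW).
      rewrite {1}/wall_form formDl linearD !formDr -!/(f _ _) !iso //.
      rewrite add0r addr0.
      by move/eqP; rewrite addr_eq0 => /eqP.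
    (* f (k u) w = - f w (k u) gives (theta k - k) f u w = 0. *)
    have [k kN] := theta_neq1.
    have := alt (k *: u) (rpredZ k uW).
    rewrite {1 2}/wall_form linearZ /= formZl formZr -!/(f _ _) -mulrN -alt //.
    move/eqP; rewrite -subr_eq0 -mulrBl mulf_eq0.
    by rewrite subr_eq0 (negPf kN) => /eqP.
  have [av|av] := eqVneq (h a v) 0; first by exists v; rewrite // /P av eqxx.
  exists ((h a v)^-1 *: v); first exact: rpredZ.
  split; last by rewrite formZr mulVf // eqxx orbT.
  rewrite /wall_form linearZ /= formZl formZr -/(f v v) !mulf_neq0 //.
    by rewrite fmorph_eq0 invr_neq0.
  by rewrite invr_neq0.
- exact: wall_form_nondeg.
have vsD v : v \in vs -> v \in limg D /\ f v v != 0.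
  by move=> vvs; split; [apply: basis_mem vsb vvs | case: (vsP v vvs)].
pose ps := [seq (v, (f v v)^-1) | v <- vs].
have ps1 : [seq p.1 | p <- ps] = vs by rewrite -map_comp map_id.
exists ps; split; last by move=> p /mapP[v /vsP[_ Pv] ->].
split; rewrite ?ps1 //.
  move=> p /mapP[v /vsD[vD fv] ->] /=; rewrite invr_neq0 // invrK.
  by rewrite wall_form_skew.
move=> x; have [] := cayley_product x vsD vs_orth; rewrite -/ps.
set y := x - _; rewrite (span_basis vsb) => yD yE.
suff : y - (x - sigma x) = 0.
  by rewrite /y opprB addrC addrA subrK => /eqP; rewrite subr_eq0 => /eqP.
have xD : x - sigma x \in limg D by rewrite -DE memv_img ?memvf.
apply: wall_form_nondeg_r; first by rewrite rpredB.
move=> u; rewrite -(span_basis vsb).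
apply: (@span_closed _ _ (fun u => f u (y - (x - sigma x)) = 0)).
- exact: form0l.
- by move=> l b c bv cv; rewrite wall_form_semilin bv cv mulr0 addr0.
- move=> v vvs; have [vD _] := vsD v vvs.
  rewrite -scaleN1r addrC wall_form_lin wall_formE // yE // mulN1r addNr //.
Qed.

End Cayley.

(** * The spinor norm of a quasi-reflection *)

Section Transfer.
Variables (F : fieldType) (E : fieldExtType F) (theta : 'AEnd(E)).
Hypotheses (two_neq0 : 2%:R != 0 :> F) (thetaK : involutive theta).
Variable mu0 : 'Hom(subvs_of (fixedSpace theta), F^o).
Hypothesis mu0_neq0 : mu0 != 0.

Local Notation mu := (fun x => mu0 (trace_fixed theta x) : F).
Local Notation e := (vbasis {:E}).

Lemma trace_form_lin : scalar mu.
Proof.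
move=> k x y; rewrite /trace_fixed linearP /= addrACA -scalerDr.
by rewrite linearP linearP.
Qed.

Lemma trace_form_theta x : mu (theta x) = mu x.
Proof. by rewrite /trace_fixed thetaK addrC. Qed.

Lemma trace_form_neq0 : exists x, mu x != 0.
Proof.
apply: contrapT => mu_0; case/eqP: mu0_neq0; apply/lfunP => w; rewrite zero_lfunE.
apply/eqP; apply: contrapT => /negP w0; apply: mu_0; exists (2%:R^-1 *: vsval w).
suff -> : trace_fixed theta (2%:R^-1 *: vsval w) = w by [].
have wfix : theta (vsval w) = vsval w by apply/fixedSpaceP/subvsP.
apply: val_inj; rewrite /= trace_fixedE // linearZ /= wfix -scalerDl.
have -> : 2%:R^-1 + 2%:R^-1 = 1 :> F by field; rewrite two_neq0.
by rewrite scale1r.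
Qed.

Variables (V : vectType E) (h : sesquilinear_form theta V).
Hypotheses (h_herm : hermitian_form h) (h_nd : nondegenerate_form h).

Local Notation b := (transfer_form mu0 h).

Lemma transfer_lin u : scalar (b u).
Proof.
move=> k x y; rewrite -trace_form_lin /transfer_form; congr (mu0 (trace_fixed theta _)).
by rewrite formDr baseVect_scaleE formZr mulr_algl.
Qed.

Lemma transferC u v : b u v = b v u.
Proof. by rewrite /transfer_form h_herm trace_form_theta. Qed.

Lemma transfer_nondeg x : (forall y, b x y = 0) -> x = 0.
Proof.
move=> bx; apply: h_nd => y; apply: contrapT => /eqP hxy.
have [z /negP] := trace_form_neq0; apply; apply/eqP.
by have := bx ((z / h x y) *: (y : V)); rewrite /transfer_form formZr divfK.
Qed.

(** The Wall form of the quasi-reflection over E, pushed down to F by mu. *)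
Lemma quasi_reflection_wall_det v psi :
  psi != 0 -> psi^-1 + theta psi^-1 = h v v ->
  has_wall_det b (quasi_reflection h (v, psi))
    (\det (gram_mx theta mu (2%:R / psi))).
Proof.
move=> psi0 psiE; exists (\dim {:E}), (fun i => e`_i *: v : baseVectType V).
have two0 := two_ext_neq0 E two_neq0.
have mu2 x : 2%:R * mu x = mu (2%:R * x).
  by have := trace_form_lin 1 x x; rewrite scale1r mul1r !mulr_natl !mulr2n.
exists (gram_mx theta mu (2%:R / psi)); split=> //; split.
- rewrite unitmxE unitfE.
  apply: det_gram_mx_neq0 => //; [exact: trace_form_lin | exact: trace_form_neq0 |].
  by rewrite mulf_neq0 ?invr_neq0.
- rewrite (gram_mx_tr thetaK trace_form_theta) -(gram_mxD _ trace_form_lin).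
  rewrite rmorphM rmorph_nat -mulrDr psiE; apply/matrixP => i j; rewrite !mxE.
  rewrite /transfer_form formZl formZr mu2; congr (mu0 (trace_fixed theta _)).
  by ring.
- move=> x; pose y := psi * h v x; exists (\col_i coord e i y).
    apply/colP => i; rewrite [LHS]mxE [RHS]mxE.
    under eq_bigr do rewrite [(\col_i _) _ _]mxE.
    rewrite (gram_mx_coord theta trace_form_lin) /transfer_form mu2 formZl.
    by congr (mu0 (trace_fixed theta _)); rewrite /y; field.
  rewrite /quasi_reflection /=; congr (_ - _ : V).
  rewrite -/y {1}(coord_vbasis (memvf y)) scaler_suml.
  by apply: eq_bigr => i _; rewrite mxE baseVect_scaleE scalerA mulr_algl.
Qed.

End Transfer.

(** * Comparison of the two spinor norms *)

Lemma eq_square_class (K : fieldType) (c d t : K) :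
  t != 0 -> c = d * t ^+ 2 -> square_class c = square_class d.
Proof.
move=> t0 ->; rewrite /square_class; apply/seteqP; split=> _ [s /= s0 <-].
  by exists (t * s); rewrite /= ?mulf_neq0 // exprMn mulrA.
by exists (s / t); rewrite /= ?mulf_neq0 ?invr_neq0 //; field.
Qed.

Theorem mainTheorem2 (F : fieldType) (E : fieldExtType F)
    (char_neq2 : 2%N \notin [pchar F])
    (theta : 'AEnd(E))
    (theta_neq1 : exists x, theta x != x) (thetaK : involutive theta)
    (mu0 : 'Hom(subvs_of (fixedSpace theta), F^o)) (mu0_neq0 : mu0 != 0)
    (V : vectType E)
    (h : sesquilinear_form theta V)
    (h_hermitian : hermitian_form h) (h_nondeg : nondegenerate_form h)
    (h' : sesquilinear_form theta V)
    (h'_antihermitian : antihermitian_form h')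
    (h'_nondeg : nondegenerate_form h')
    (same_unitary_group : isometry_group h' = isometry_group h)
    (a : V) (sigma : 'End(V)) (sigma_unitary : isometry_group h' sigma) :
  spinor_norm (transfer_form mu0 h) (base_lfun sigma) =
  norm_class (unitary_spinor_norm h' a sigma).
Proof.
have two_neq0 : 2%:R != 0 :> F by apply: contraNneq char_neq2 => /eqP.
set b := transfer_form mu0 h.
have b_lin u : scalar (b u) by apply: transfer_lin.
have bC u v : b u v = b v u by apply: transferC.
have [bsig_ker bsig] : isometry_group b (base_lfun sigma).
  by apply: base_lfun_isometry; rewrite -same_unitary_group.
rewrite /spinor_norm /unitary_spinor_norm.
have := xgetPex [::] (exists_reflection_product two_neq0 b_lin bC
  (transfer_nondeg two_neq0 thetaK mu0_neq0 h_nondeg) bsig).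
set vs := xget _ _ => -[bvs vsE].
have := xgetPex [::] (exists_normalized_decomposition thetaK theta_neq1
  h'_antihermitian h'_nondeg sigma_unitary a).
set ps := xget _ _ => -[[psP psb _ psE] _].
(* The Wall matrix of the quasi-reflection (v, phi) of h' is built from h. *)
have ps_disc p : p \in ps ->
    has_wall_disc b (quasi_reflection h' p) (field_norm p.2).
  case: p => v phi pps; have /= [phi0 phiE] := psP _ pps.
  have v0 : v != 0 by apply: basis_not0 psb _; apply/mapP; exists (v, phi).
  have [lam [lam0 lamN h'E]] := same_group_ratio two_neq0 thetaK theta_neq1
    h_hermitian h_nondeg h'_antihermitian h'_nondeg same_unitary_group v0.
  have [||t t0 tE] := det_gram_mx_square two_neq0 thetaK
    (trace_form_lin mu0) (trace_form_theta thetaK mu0)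
    (trace_form_neq0 two_neq0 thetaK mu0_neq0) (z := 2%:R / lam).
  - by rewrite mulf_neq0 ?invr_neq0 ?two_ext_neq0.
  - by rewrite rmorphM rmorph_nat fmorphV /= lamN invrN mulrN.
  have Nphi0 := field_norm_neq0 phi0.
  exists (t / field_norm phi); first by rewrite mulf_neq0 ?invr_neq0.
  have -> : quasi_reflection h' (v, phi) = quasi_reflection h (v, phi * lam).
    by apply/funext => x; rewrite /quasi_reflection /= h'E mulrA.
  have -> : field_norm phi * (t / field_norm phi) ^+ 2 =
      \det (gram_mx theta (fun x => mu0 (trace_fixed theta x))
             (2%:R / (phi * lam))).
    apply: (mulIf Nphi0); rewrite -(det_gram_mxM theta (trace_form_lin mu0)).
    have -> : 2%:R / (phi * lam) * phi = 2%:R / lam by field; rewrite lam0 phi0.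
    by rewrite tE; field.
  apply: quasi_reflection_wall_det => //; first by rewrite mulf_neq0.
  apply: (mulfI lam0); rewrite -h'E -phiE rmorphV ?unitfE ?mulf_neq0 // rmorphM.
  rewrite /= lamN fmorphV /=; field.
  by rewrite fmorph_eq0 phi0 oppr_eq0 lam0.
have vs_disc v : v \in rev vs -> has_wall_disc b (reflection b v) (b v v).
  rewrite mem_rev => /(allP bvs) bv.
  by exists 1; rewrite ?oner_neq0 // expr1n mulr1; apply: wall_det_reflection.
have [s s0 vs_wall] := wall_disc_foldr b_lin bC vs_disc.
have [t t0 ps_wall] := wall_disc_foldr b_lin bC ps_disc.
have := wall_det_comp b_lin bC vs_wall ps_wall.
have -> : (fun x => foldr (reflection b) x (rev vs)) \o
    (fun x => foldr (quasi_reflection h') x ps) = id.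
  apply/funext => x /=; rewrite -psE.
  by rewrite -(base_lfunE sigma x) vsE foldr_reflectionK.
move=> /(wall_det_id_square two_neq0 b_lin) [q q0].
rewrite (perm_big _ (permEl (perm_rev vs))) /=.
rewrite -(field_norm_prod _ (fun p : V * E => p.2)).
set B := \prod_(v <- vs) _; set Phi := \prod_(p <- ps) _ => BPhi.
have Phi0 : Phi != 0.
  by rewrite prodf_seq_neq0; apply/allP => p /psP[].
have NPhi0 := field_norm_neq0 Phi0.
have -> : square_class B = square_class (field_norm Phi).
  apply: (@eq_square_class _ _ _ (q / (s * t * field_norm Phi))).
    by rewrite !mulf_neq0 ?invr_neq0 ?mulf_neq0.
  rewrite expr_div_n -BPhi; field.
  by rewrite s0 t0 NPhi0.
apply/seteqP; split=> c.
  move=> cPhi; exists Phi => //; exists 1; last by rewrite mulr1.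
  by rewrite /= oner_neq0 andbT; apply/fixedSpaceP; rewrite rmorph1.
move=> [_ [y /andP[/fixedSpaceP yfix y0] <-]].
have [r r0 rE] := field_norm_fixed_square two_neq0 thetaK
    (trace_form_lin mu0) (trace_form_theta thetaK mu0)
    (trace_form_neq0 two_neq0 thetaK mu0_neq0) theta_neq1 y0 yfix.
by rewrite (@eq_square_class _ _ (field_norm Phi) r) // field_normM rE.
Qed.
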